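(* Let $\mathcal P$ be a contractad in a symmetric monoidal category $\mathcal C$. Then the $\Sigma$-module $\mathsf K_*(\mathcal P)$, $\mathsf K_*(\mathcal P)(n):=\mathcal P(\mathsf K_n)$ for $n\ge1$, with $\Sigma_n=\mathrm{Aut}(\mathsf K_n)$ acting through the graphical collection structure, has a natural structure of a symmetric operad obtained from the contractad structure of $\mathcal P$: its unit is that of $\mathcal P$ and its partial compositions $\circ_i:\mathcal P(\mathsf K_n)\otimes\mathcal P(\mathsf K_m)\to\mathcal P(\mathsf K_{n+m-1})$ are the infinitesimal compositions $\circ^{\mathsf K_{n+m-1}}_G$ with $G=\{i,i+1,\dots,i+m-1\}$.
   Context: Graphs are finite, simple, undirected, with non-empty vertex set. A tube of $\Gamma$ is a non-empty $G\subset V_\Gamma$ with connected induced subgraph $\Gamma|_G$. For a tube $G$, $\Gamma/G$ is the graph with vertices $\{G\}$ and $\{v\}$, $v\notin G$, two distinct blocks being adjacent iff their union is a tube. $\mathsf P_1$ is the one-vertex graph and $\mathsf K_n$ the complete graph on $\{1,\dots,n\}$. A graphical collection in $\mathcal C$ is a contravariant functor $\mathcal P$ from the groupoid of connected graphs and isomorphisms to $\mathcal C$. A contractad is a graphical collection with a unit $u:1_{\mathcal C}\to\mathcal P(\mathsf P_1)$ and infinitesimal compositions $\circ^\Gamma_G:\mathcal P(\Gamma/G)\otimes\mathcal P(\Gamma|_G)\to\mathcal P(\Gamma)$, for all connected $\Gamma$ and tubes $G$, natural under graph isomorphisms and satisfying (in element notation, with symmetry isomorphisms of $\mathcal C$ understood):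 $\lambda\circ_{\{v\}}\mathrm{Id}=\lambda=\mathrm{Id}\circ_{V_\Gamma}\lambda$, where $\mathrm{Id}$ is given by $u$; $(\lambda\circ_{G_2}\nu_2)\circ_{G_1}\nu_1=(\lambda\circ_{G_1}\nu_1)\circ_{G_2}\nu_2$ for disjoint tubes $G_1,G_2$; $\lambda\circ_H(\mu\circ_G\nu)=(\lambda\circ_{H/G}\mu)\circ_G\nu$ for tubes $G\subset H$, where $H/G$ is the image of $H$ in $\Gamma/G$. Here $\mathsf K_{n+m-1}/G$ and $\mathsf K_{n+m-1}|_G$ are identified with $\mathsf K_n$ and $\mathsf K_m$ by the order-preserving relabellings of vertices (blocks ordered by minimal elements). A $\Sigma$-module here is a sequence of objects with right $\Sigma_n$-actions, $n\ge1$. *)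

(* Defs.v *)
From HB Require Import structures.
From mathcomp Require Import all_boot perm zify.

Set Implicit Arguments.
Unset Strict Implicit.
Unset Printing Implicit Defensive.

Reserved Notation "g \c f" (at level 50, left associativity).
Reserved Notation "A \ox B" (at level 40, left associativity).
Reserved Notation "f \om g" (at level 40, left associativity).

Record symMonCat := SymMonCat {
  Obj :> Type;
  Hom : Obj -> Obj -> Type;
  idm : forall A, Hom A A;
  cmp : forall A B C, Hom B C -> Hom A B -> Hom A C
    where "g \c f" := (cmp g f);
  cmp1m : forall A B (f : Hom A B), idm B \c f = f;
  cmpm1 : forall A B (f : Hom A B), f \c idm A = f;
  cmpA : forall A B C D (h : Hom C D) (g : Hom B C) (f : Hom A B),
    h \c (g \c f) = (h \c g) \c f;

  unitO : Obj;
  tens : Obj -> Obj -> Obj where "A \ox B" := (tens A B);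
  tensm : forall A A' B B', Hom A A' -> Hom B B' -> Hom (A \ox B) (A' \ox B')
    where "f \om g" := (tensm f g);
  tensm1 : forall A B, idm A \om idm B = idm (A \ox B);
  tensmM : forall A A' A'' B B' B'' (f' : Hom A' A'') (f : Hom A A')
      (g' : Hom B' B'') (g : Hom B B'),
    (f' \c f) \om (g' \c g) = (f' \om g') \c (f \om g);

  assoc : forall A B C, Hom ((A \ox B) \ox C) (A \ox (B \ox C));
  assocV : forall A B C, Hom (A \ox (B \ox C)) ((A \ox B) \ox C);
  assocK : forall A B C, assocV A B C \c assoc A B C = idm _;
  assocVK : forall A B C, assoc A B C \c assocV A B C = idm _;
  assoc_nat : forall A A' B B' C C' (f : Hom A A') (g : Hom B B') (h : Hom C C'),
    assoc A' B' C' \c ((f \om g) \om h) = (f \om (g \om h)) \c assoc A B C;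

  lunit : forall A, Hom (unitO \ox A) A;
  lunitV : forall A, Hom A (unitO \ox A);
  lunitK : forall A, lunitV A \c lunit A = idm _;
  lunitVK : forall A, lunit A \c lunitV A = idm _;
  lunit_nat : forall A B (f : Hom A B),
    lunit B \c (idm unitO \om f) = f \c lunit A;

  runit : forall A, Hom (A \ox unitO) A;
  runitV : forall A, Hom A (A \ox unitO);
  runitK : forall A, runitV A \c runit A = idm _;
  runitVK : forall A, runit A \c runitV A = idm _;
  runit_nat : forall A B (f : Hom A B),
    runit B \c (f \om idm unitO) = f \c runit A;

  pentagon : forall A B C D,
    assoc A B (C \ox D) \c assoc (A \ox B) C D
    = (idm A \om assoc B C D) \c assoc A (B \ox C) D \c (assoc A B C \om idm D);
  triangle : forall A B,
    (idm A \om lunit B) \c assoc A unitO B = runit A \om idm B;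

  braid : forall A B, Hom (A \ox B) (B \ox A);
  braid_nat : forall A A' B B' (f : Hom A A') (g : Hom B B'),
    braid A' B' \c (f \om g) = (g \om f) \c braid A B;
  braidK : forall A B, braid B A \c braid A B = idm _;
  hexagon : forall A B C,
    assoc B C A \c braid A (B \ox C) \c assoc A B C
    = (idm B \om braid A C) \c assoc B A C \c (braid A B \om idm C)
}.

Arguments Hom {s}.
Arguments idm {s}.
Arguments cmp {s A B C}.
Arguments unitO {s}.
Arguments tens {s}.
Arguments tensm {s A A' B B'}.
Arguments assoc {s}.
Arguments assocV {s}.
Arguments lunit {s}.
Arguments runit {s}.
Arguments braid {s}.

Declare Scope smc_scope.
Delimit Scope smc_scope with smc.
Notation "g \c f" := (cmp g f) : smc_scope.
Notation "A \ox B" := (tens A B) : smc_scope.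
Notation "f \om g" := (tensm f g) : smc_scope.
Local Open Scope smc_scope.

Definition swap23 (C : symMonCat) (A B D : C) :
    Hom ((A \ox B) \ox D) ((A \ox D) \ox B) :=
  assocV A D B \c (idm A \om braid B D) \c assoc A B D.

Record graph := Graph {
  vert :> finType;
  adj : rel vert;
  adj_sym : symmetric adj;
  adj_irr : irreflexive adj
}.
Arguments adj {g}.

Definition connected (G : graph) : bool :=
  (0 < #|G|) && [forall x : G, forall y : G, connect adj x y].

Record cgraph := CGraph { cgr :> graph; cgr_conn : connected cgr }.

Lemma connectedP (G : graph) :
  reflect ((exists x : G, True) /\
    forall S : {set G}, (exists x, x \in S) ->
      (forall x y, x \in S -> adj x y -> y \in S) -> forall y, y \in S)
   (connected G).
Proof.
apply: (iffP andP) => -[].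
- move=> /card_gt0P[x0 _] /forallP cG; split; first by exists x0.
  move=> S [x xS] clS y; have /forallP/(_ y)/connectP[p] := cG x.
  elim: p x xS => [|z p IHp] x xS /=; first by move=> _ ->.
  by case/andP=> /(clS _ _ xS) zS; apply: IHp.
- case=> x0 _ cG; split; first by apply/card_gt0P; exists x0.
  apply/forallP=> x; apply/forallP=> y.
  have : y \in [set z | connect (@adj G) x z].
    apply: cG; first by exists x; rewrite inE connect0.
    by move=> u v; rewrite !inE => xu uv; apply: connect_trans xu (connect1 uv).
  by rewrite inE.
Qed.

Section Induced.
Variables (G : graph) (A : {set G}).

Definition ind_adj (x y : {x : G | x \in A}) := adj (val x) (val y).

Lemma ind_adj_sym : symmetric ind_adj.
Proof. by move=> x y; apply: adj_sym. Qed.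

Lemma ind_adj_irr : irreflexive ind_adj.
Proof. by move=> x; apply: adj_irr. Qed.

Definition induced : graph := Graph ind_adj_sym ind_adj_irr.

End Induced.

Definition is_tube (G : graph) (A : {set G}) : bool := connected (induced A).

Record tube (G : graph) := Tube { tset :> {set G}; tsetP : is_tube tset }.

Definition restr (G : graph) (A : tube G) : cgraph := CGraph (tsetP A).

Lemma tubeP (G : graph) (A : {set G}) :
  reflect ((exists x, x \in A) /\
    forall S : {set G}, (exists2 x, x \in A & x \in S) ->
      (forall x y, x \in A -> y \in A -> x \in S -> adj x y -> y \in S) ->
      {subset A <= S})
   (is_tube A).
Proof.
apply: (iffP (connectedP _)) => -[].
- case=> x0 _ cA; split; first by exists (val x0); apply: valP.
  move=> S [x xA xS] clS y yA.
  have := cA [set z | val z \in S] _ _ (exist _ y yA); rewrite inE; apply.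
    by exists (exist _ x xA); rewrite inE.
  by move=> u v; rewrite !inE => uS uv; apply: clS uv => //; apply: valP.
- case=> x0 x0A cA; split; first by exists (exist _ x0 x0A).
  move=> S [x xS] clS y.
  have : val y \in [set val z | z in S].
    apply: cA (valP y); first by exists (val x); [apply: valP | apply: imset_f].
    move=> u v uA vA /imsetP[z zS uz] uv; apply/imsetP.
    exists (exist _ v vA) => //; apply: clS zS _.
    by rewrite /= /ind_adj -uz.
  by case/imsetP=> z zS /val_inj->.
Qed.

(* A surjection along which the adjacency of [H] is the image of that of [G]:
   edges inside a fibre are forgotten, all others are kept. *)
Record quot (G H : graph) := Quot {
  qfun :> G -> H;
  quot_surj : forall a, [exists x, qfun x == a];
  quot_adj : forall a b,
    adj a b = (a != b) && [exists x, exists y,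
                            [&& qfun x == a, qfun y == b & adj x y]]
}.

Definition is_giso (G H : graph) (f : {ffun G -> H}) : bool :=
  [&& injectiveb f, [forall y, exists x, f x == y]
    & [forall x, forall y, adj (f x) (f y) == adj x y]].

Record giso (G H : graph) := GIso { gfun :> {ffun G -> H}; gisoP : is_giso gfun }.

Lemma giso_eq (G H : graph) (f g : giso G H) : f =1 g -> f = g.
Proof.
case: f g => f fP [g gP] /= /ffunP fg.
by move: fP gP; rewrite fg => p q; rewrite (bool_irrelevance p q).
Qed.

Section GIsoTheory.
Variables (G H : graph) (f : giso G H).

Lemma giso_inj : injective f.
Proof. by apply/injectiveP; case/and3P: (gisoP f). Qed.

Lemma giso_surj y : [exists x, f x == y].
Proof. by case/and3P: (gisoP f) => _ /forallP. Qed.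

Lemma giso_adj x y : adj (f x) (f y) = adj x y.
Proof. by case/and3P: (gisoP f) => _ _ /forallP/(_ x)/forallP/(_ y)/eqP. Qed.

End GIsoTheory.

Lemma giso_id_subproof (G : graph) : is_giso [ffun x : G => x].
Proof.
apply/and3P; split.
- by apply/injectiveP=> x y; rewrite !ffunE.
- by apply/forallP=> y; apply/existsP; exists y; rewrite ffunE.
- by apply/forallP=> x; apply/forallP=> y; rewrite !ffunE.
Qed.

Definition giso_id (G : graph) : giso G G := GIso (giso_id_subproof G).

Lemma giso_comp_subproof (G H K : graph) (g : giso H K) (f : giso G H) :
  is_giso [ffun x => g (f x)].
Proof.
apply/and3P; split.
- by apply/injectiveP=> x y; rewrite !ffunE => /giso_inj/giso_inj.
- apply/forallP=> z; have /existsP[y /eqP<-] := giso_surj g z.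
  have /existsP[x /eqP<-] := giso_surj f y.
  by apply/existsP; exists x; rewrite ffunE.
- by apply/forallP=> x; apply/forallP=> y; rewrite !ffunE !giso_adj.
Qed.

Definition giso_comp (G H K : graph) (g : giso H K) (f : giso G H) : giso G K :=
  GIso (giso_comp_subproof g f).

Lemma quot_of_giso_adj (G H : graph) (f : giso G H) a b :
  adj a b = (a != b) && [exists x, exists y, [&& f x == a, f y == b & adj x y]].
Proof.
apply/idP/andP=> [ab | [_ /existsP[x /existsP[y]]]]; last first.
  by case/and3P=> /eqP<- /eqP<-; rewrite giso_adj.
split; first by apply/eqP=> eab; rewrite eab adj_irr in ab.
have /existsP[x /eqP fx] := giso_surj f a.
have /existsP[y /eqP fy] := giso_surj f b.
apply/existsP; exists x; apply/existsP; exists y.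
by rewrite fx fy !eqxx -(giso_adj f) fx fy.
Qed.

Definition quot_of_giso (G H : graph) (f : giso G H) : quot G H :=
  Quot (giso_surj f) (quot_of_giso_adj f).

Definition quot_id (G : graph) : quot G G := quot_of_giso (giso_id G).

Section QuotComp.
Variables (G H K : graph) (q : quot H K) (p : quot G H).

Lemma quot_comp_surj a : [exists x, q (p x) == a].
Proof.
have /existsP[y /eqP<-] := quot_surj q a.
have /existsP[x /eqP<-] := quot_surj p y.
by apply/existsP; exists x.
Qed.

Lemma quot_comp_adj a b :
  adj a b = (a != b) && [exists x, exists y,
                          [&& q (p x) == a, q (p y) == b & adj x y]].
Proof.
rewrite (quot_adj q); case: eqVneq => //= ab.
apply/existsP/existsP=> -[x /existsP[y /and3P[/eqP qx /eqP qy xy]]].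
- move: xy; rewrite (quot_adj p) => /andP[_ /existsP[u /existsP[v]]].
  case/and3P=> /eqP pu /eqP pv uv; exists u; apply/existsP; exists v.
  by rewrite pu pv qx qy !eqxx.
- exists (p x); apply/existsP; exists (p y); rewrite qx qy !eqxx (quot_adj p) /=.
  apply/andP; split; first by apply: contraNneq ab => e; rewrite -qx -qy e.
  by apply/existsP; exists x; apply/existsP; exists y; rewrite !eqxx.
Qed.

Definition quot_comp : quot G K := Quot quot_comp_surj quot_comp_adj.

End QuotComp.

(* Two quotient maps out of the same graph with the same fibres have
   canonically isomorphic targets, through [p x |-> q x]. *)
Section QuotIso.
Variables (G A B : graph) (p : quot G A) (q : quot G B).
Hypothesis pq : forall x y, p x = p y <-> q x = q y.

Definition quot_rep (a : A) : G := xchoose (existsP (quot_surj p a)).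

Lemma quot_repK a : p (quot_rep a) = a.
Proof. exact/eqP/(xchooseP (existsP (quot_surj p a))). Qed.

Definition quot_iso_fun : {ffun A -> B} := [ffun a => q (quot_rep a)].

Lemma quot_iso_funE x : quot_iso_fun (p x) = q x.
Proof. by rewrite ffunE; apply/pq; rewrite quot_repK. Qed.

Lemma quot_iso_subproof : is_giso quot_iso_fun.
Proof.
have inj : injective quot_iso_fun.
  move=> a b; have /existsP[x /eqP<-] := quot_surj p a.
  have /existsP[y /eqP<-] := quot_surj p b.
  by rewrite !quot_iso_funE => /pq.
apply/and3P; split; first exact/injectiveP.
- apply/forallP=> b; have /existsP[x /eqP<-] := quot_surj q b.
  by apply/existsP; exists (p x); rewrite quot_iso_funE.
- apply/forallP=> a; apply/forallP=> b.
  rewrite (quot_adj p) (quot_adj q) (inj_eq inj); apply/eqP; congr (_ && _).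
  have /existsP[x0 /eqP<-] := quot_surj p a.
  have /existsP[y0 /eqP<-] := quot_surj p b.
  rewrite !quot_iso_funE.
  apply/existsP/existsP=> -[x /existsP[y /and3P[/eqP qx /eqP qy xy]]];
    exists x; apply/existsP; exists y; rewrite xy andbT;
    by apply/andP; split; apply/eqP; apply/pq.
Qed.

Definition quot_iso : giso A B := GIso quot_iso_subproof.

Lemma quot_isoE x : quot_iso (p x) = q x.
Proof. exact: quot_iso_funE. Qed.

End QuotIso.

Lemma quot_imset_tube (G H : graph) (p : quot G H) (A : {set G}) :
  is_tube A -> is_tube (p @: A).
Proof.
case/tubeP=> -[x0 x0A] cA; apply/tubeP.
split; first by exists (p x0); apply: imset_f.
move=> S [_ /imsetP[x xA ->] xS] clS _ /imsetP[y yA ->].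
have := cA [set z | p z \in S] _ _ y yA; rewrite inE; apply.
  by exists x; rewrite ?inE.
move=> u v uA vA; rewrite !inE => uS uv.
have [<-//|npuv] := eqVneq (p u) (p v).
apply: clS uS _; [exact: imset_f | exact: imset_f |].
rewrite (quot_adj p) npuv; apply/existsP; exists u; apply/existsP; exists v.
by rewrite !eqxx.
Qed.

Definition im_tube (G H : graph) (p : quot G H) (A : tube G) : tube H :=
  Tube (quot_imset_tube p (tsetP A)).

Section QuotRestr.
Variables (G H : graph) (p : quot G H) (A : tube G).
Hypothesis satA : forall x y, x \in (A : {set G}) -> p x = p y -> y \in (A : {set G}).

Lemma quot_restr_in (x : restr A) : p (val x) \in im_tube p A.
Proof. exact/imset_f/(valP x). Qed.

Definition quot_restr_fun (x : restr A) : restr (im_tube p A) :=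
  exist _ (p (val x)) (quot_restr_in x).

Lemma quot_restr_surj a : [exists x, quot_restr_fun x == a].
Proof.
case/imsetP: (valP a) => x xA ax.
by apply/existsP; exists (exist _ x xA); rewrite -val_eqE /= ax.
Qed.

Lemma quot_restr_adj a b :
  adj a b = (a != b) && [exists x, exists y,
    [&& quot_restr_fun x == a, quot_restr_fun y == b & adj x y]].
Proof.
change (adj a b) with (adj (val a) (val b)).
rewrite (quot_adj p) val_eqE; congr (_ && _).
apply/existsP/existsP=> -[x /existsP[y /and3P[/eqP qx /eqP qy xy]]].
- have inA z (c : restr (im_tube p A)) : p z = val c -> z \in (A : {set G}).
    move=> pz; case/imsetP: (valP c) => w wA cw.
    by apply: (satA wA); rewrite -cw pz.
  exists (exist _ x (inA _ _ qx)); apply/existsP; exists (exist _ y (inA _ _ qy)).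
  by rewrite -!val_eqE /= qx qy !eqxx.
- exists (val x); apply/existsP; exists (val y).
  by rewrite -qx -qy /= !eqxx.
Qed.

Definition quot_restr : quot (restr A) (restr (im_tube p A)) :=
  Quot quot_restr_surj quot_restr_adj.

End QuotRestr.

Section Contraction.
Variables (G : cgraph) (A : tube G).

Definition blocks : {set {set G}} :=
  (A : {set G}) |: [set [set v] | v in ~: (A : {set G})].

Definition contr_adj (B B' : {B : {set G} | B \in blocks}) : bool :=
  (B != B') && is_tube (val B :|: val B').

Lemma contr_adj_sym : symmetric contr_adj.
Proof. by move=> B B'; rewrite /contr_adj eq_sym setUC. Qed.

Lemma contr_adj_irr : irreflexive contr_adj.
Proof. by move=> B; rewrite /contr_adj eqxx. Qed.

Definition contr_graph : graph := Graph contr_adj_sym contr_adj_irr.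

Definition block_set (v : G) : {set G} :=
  if v \in (A : {set G}) then (A : {set G}) else [set v].

Lemma block_set_in v : block_set v \in blocks.
Proof.
rewrite /block_set in_setU1; case: ifPn => [_|vA]; first by rewrite eqxx.
by rewrite imset_f ?orbT // inE.
Qed.

Definition block (v : G) : contr_graph := exist _ (block_set v) (block_set_in v).

Lemma block_mem v : v \in val (block v).
Proof. by rewrite /= /block_set; case: ifP => //; rewrite inE. Qed.

Lemma blockE (B : contr_graph) v : v \in val B -> B = block v.
Proof.
move=> vB; apply: val_inj => /=; rewrite /block_set.
have := valP B; rewrite in_setU1 => /orP[/eqP eB | /imsetP[w]].
  by rewrite -eB vB.
rewrite inE => wA eB; move: vB; rewrite eB inE => /eqP->.
by rewrite (negPf wA).
Qed.

Lemma block_tube (B : contr_graph) : is_tube (val B).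
Proof.
have := valP B; rewrite in_setU1 => /orP[/eqP-> | /imsetP[w _ ->]].
  exact: tsetP.
apply/tubeP; split; first by exists w; rewrite inE.
by move=> S [x /set1P-> wS] _ y /set1P->.
Qed.

Lemma block_eq x y :
  block x = block y <-> x = y \/ x \in (A : {set G}) /\ y \in (A : {set G}).
Proof.
split=> [exy | [->//|[xA yA]]]; last first.
  by apply: val_inj; rewrite /= /block_set xA yA.
have := block_mem x; rewrite exy /= /block_set.
case: ifP => [yA xA | _ /set1P]; [by right | by left].
Qed.

Lemma block_surj B : [exists x, block x == B].
Proof.
have /tubeP[[x xB] _] := block_tube B.
by apply/existsP; exists x; rewrite eq_sym; apply/eqP/blockE.
Qed.

Lemma block_adj (B B' : contr_graph) :
  adj B B' = (B != B') && [exists x, exists y,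
                            [&& block x == B, block y == B' & adj x y]].
Proof.
change (adj B B') with ((B != B') && is_tube (val B :|: val B')).
case: eqVneq => //= nBB'.
have /tubeP[[x0 x0B] cB] := block_tube B.
have /tubeP[[y0 y0B'] cB'] := block_tube B'.
apply/tubeP/existsP=> [[_ cBB'] | [x /existsP[y]]].
- pose S := [set z | (z \in val B) ].
  apply/existsP; apply: contraNT nBB' => noedge.
  have : y0 \in S.
    apply: (cBB' S); last by rewrite inE y0B' orbT.
      by exists x0; rewrite inE ?x0B.
    move=> u v; rewrite !inE => _ /orP[//|vB'] uB uv.
    case/negP: noedge; apply/existsP; exists u; apply/existsP; exists v.
    by rewrite -(blockE uB) -(blockE vB') !eqxx.
  by rewrite inE => /blockE ->; rewrite (blockE y0B').
- case/and3P=> /eqP bx /eqP by_ xy.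
  have xB : x \in val B by rewrite -bx block_mem.
  have yB' : y \in val B' by rewrite -by_ block_mem.
  split; first by exists x; rewrite inE xB.
  move=> S [u uBB' uS] clS.
  have clB : (exists2 z, z \in val B & z \in S) -> {subset val B <= S}.
    move=> ex; apply: cB => // v w vB wB; apply: clS; rewrite inE ?vB ?wB //.
  have clB' : (exists2 z, z \in val B' & z \in S) -> {subset val B' <= S}.
    move=> ex; apply: cB' => // v w vB wB; apply: clS; rewrite inE ?vB ?wB ?orbT //.
  have both : {subset val B <= S} /\ {subset val B' <= S}.
    case/setUP: uBB' => [uB | uB'].
      have sB : {subset val B <= S} by apply: clB; exists u.
      split=> //; apply: clB'; exists y => //.
      by apply: clS xy; rewrite ?inE ?xB ?yB' ?orbT //; apply: sB.
    have sB' : {subset val B' <= S} by apply: clB'; exists u.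
    split=> //; apply: clB; exists x => //.
    by apply: (clS y); rewrite ?inE ?xB ?yB' ?orbT 1?adj_sym //; apply: sB'.
  by case: both => sB sB' z /setUP[/sB|/sB'].
Qed.

Definition proj : quot G contr_graph := Quot block_surj block_adj.

Lemma contr_conn : connected contr_graph.
Proof.
have /connectedP[[x0 _] cG] := cgr_conn G.
apply/connectedP; split; first by exists (block x0).
move=> S [B BS] clS B'; have /existsP[y /eqP<-] := block_surj B'.
have := cG [set z | block z \in S] _ _ y; rewrite inE; apply.
  by have /existsP[x /eqP xB] := block_surj B; exists x; rewrite inE xB.
move=> u v; rewrite !inE => uS uv.
have [<-//|nuv] := eqVneq (block u) (block v).
apply: clS uS _; rewrite block_adj nuv; apply/existsP; exists u.
by apply/existsP; exists v; rewrite !eqxx.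
Qed.

Definition contr : cgraph := CGraph contr_conn.

End Contraction.

(* [H/G], the image of [H] in the contraction of [G]. *)
Definition tube_proj (G : cgraph) (A H : tube G) : tube (contr A) :=
  im_tube (proj A) H.

Lemma giso_subproof (G H : graph) (f : G -> H) :
  injective f -> (forall y, exists x, f x = y) ->
  (forall x y, adj (f x) (f y) = adj x y) -> is_giso [ffun x => f x].
Proof.
move=> fI fS fA; apply/and3P; split.
- by apply/injectiveP=> x y; rewrite !ffunE => /fI.
- apply/forallP=> y; have [x <-] := fS y.
  by apply/existsP; exists x; rewrite ffunE.
- by apply/forallP=> x; apply/forallP=> y; rewrite !ffunE fA.
Qed.

Definition giso_mk (G H : graph) (f : G -> H) (fI : injective f)
    (fS : forall y, exists x, f x = y)
    (fA : forall x y, adj (f x) (f y) = adj x y) : giso G H :=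
  GIso (giso_subproof fI fS fA).

Section NaturalityIsos.
Variables (G H : cgraph) (f : giso G H) (A : tube G).

Definition giso_tube : tube H := im_tube (quot_of_giso f) A.

Lemma contr_giso_subproof x y :
  proj A x = proj A y <->
  quot_comp (proj giso_tube) (quot_of_giso f) x
  = quot_comp (proj giso_tube) (quot_of_giso f) y.
Proof.
apply: (iff_trans (block_eq A x y)).
apply: iff_sym; apply: (iff_trans (block_eq giso_tube (f x) (f y))).
rewrite /= !(mem_imset _ _ (@giso_inj _ _ f)).
by split=> -[e|?]; [left; apply: giso_inj e | right | left; rewrite e | right].
Qed.

(* [block x |-> block (f x)] *)
Definition contr_giso : giso (contr A) (contr giso_tube) :=
  quot_iso contr_giso_subproof.

Lemma restr_giso_subproof1 x y :
  x \in (A : {set G}) -> quot_of_giso f x = quot_of_giso f y -> y \in (A : {set G}).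
Proof. by move=> xA /= /giso_inj <-. Qed.

Lemma restr_giso_subproof2 x y :
  quot_id (restr A) x = quot_id (restr A) y <->
  quot_restr restr_giso_subproof1 x = quot_restr restr_giso_subproof1 y.
Proof.
rewrite /= !ffunE; split=> [->//|/(congr1 val)/= /giso_inj]; exact: val_inj.
Qed.

(* [x |-> f x] *)
Definition restr_giso : giso (restr A) (restr giso_tube) :=
  quot_iso restr_giso_subproof2.

End NaturalityIsos.

(* [complete n] is the complete graph on [n.+1] vertices, labelled from 0. *)
Section Complete.
Variable n : nat.

Definition complete_adj (x y : 'I_n.+1) : bool := x != y.

Lemma complete_adj_sym : symmetric complete_adj.
Proof. by move=> x y; rewrite /complete_adj eq_sym. Qed.

Lemma complete_adj_irr : irreflexive complete_adj.
Proof. by move=> x; rewrite /complete_adj eqxx. Qed.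

Definition complete_graph : graph := Graph complete_adj_sym complete_adj_irr.

Lemma complete_tube (A : {set complete_graph}) : A != set0 -> is_tube A.
Proof.
move=> /set0Pn[x0 x0A]; apply/tubeP; split; first by exists x0.
move=> S [x xA xS] clS y yA; have [<-//|nxy] := eqVneq x y.
exact: (clS x).
Qed.

Lemma complete_conn : connected complete_graph.
Proof.
apply/connectedP; split; first by exists ord0.
move=> S [x xS] clS y; have [<-//|nxy] := eqVneq x y.
exact: (clS x).
Qed.

Definition complete : cgraph := CGraph complete_conn.

End Complete.

(* The one-vertex graph is the complete graph [K_1]. *)
Definition P1 : cgraph := complete 0.

Section PointIsos.
Variable G : cgraph.

Lemma quot_P1_surj a : [exists x : G, (ord0 : P1) == a].
Proof.
have /connectedP[[x _] _] := cgr_conn G.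
by apply/existsP; exists x; rewrite ord1.
Qed.

Lemma quot_P1_adj (a b : P1) :
  adj a b = (a != b) && [exists x : G, exists y : G,
                          [&& (ord0 : P1) == a, (ord0 : P1) == b & adj x y]].
Proof. by rewrite !ord1 eqxx adj_irr. Qed.

Definition quot_P1 : quot G P1 := Quot quot_P1_surj quot_P1_adj.

Lemma tube1_subproof (v : G) : is_tube [set v].
Proof.
apply/tubeP; split; first by exists v; rewrite inE.
by move=> S [x /set1P-> wS] _ y /set1P->.
Qed.

Definition tube1 (v : G) : tube G := Tube (tube1_subproof v).

Lemma tubeT_subproof : is_tube [set: G].
Proof.
have /connectedP[[x0 _] cG] := cgr_conn G.
apply/tubeP; split; first by exists x0; rewrite inE.
move=> S [x _ xS] clS y _; apply: cG => //; first by exists x.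
by move=> u v; apply: clS; rewrite inE.
Qed.

Definition tubeT : tube G := Tube tubeT_subproof.

Lemma contr_tube1_subproof v x y :
  proj (tube1 v) x = proj (tube1 v) y <-> quot_id G x = quot_id G y.
Proof.
rewrite /= !ffunE; apply: (iff_trans (block_eq (tube1 v) x y)).
by rewrite /= !inE; split=> [[//|[/eqP-> /eqP->]]|->] //; left.
Qed.

(* [{x} |-> x] *)
Definition contr_tube1 (v : G) : giso (contr (tube1 v)) G :=
  quot_iso (contr_tube1_subproof v).

Lemma restr_tube1_subproof v (x y : restr (tube1 v)) : x = y.
Proof. by apply: val_inj; rewrite (set1P (valP x)) (set1P (valP y)). Qed.

Definition restr_tube1 (v : G) : giso (restr (tube1 v)) P1.
Proof.
apply: (@giso_mk (restr (tube1 v)) P1 (fun=> ord0 : 'I_1)) => [x y _ | y | x y].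
- exact: restr_tube1_subproof.
- by exists (exist _ v (set11 v)); rewrite ord1.
- by rewrite (restr_tube1_subproof x y) !adj_irr.
Defined.

Lemma contr_tubeT_subproof x y :
  proj tubeT x = proj tubeT y <-> quot_P1 x = quot_P1 y.
Proof. by split=> // _; apply/block_eq; right; rewrite !inE. Qed.

Definition contr_tubeT : giso (contr tubeT) P1 := quot_iso contr_tubeT_subproof.

Definition restr_tubeT : giso (restr tubeT) G.
Proof.
apply: (@giso_mk (restr tubeT) G (fun x => val x)) => [x y | y | x y //].
- exact: val_inj.
- by exists (exist _ y (in_setT y)).
Defined.

End PointIsos.

Section DisjointTubes.
Variables (G : cgraph) (A B : tube G).
Hypothesis AB : [disjoint (A : {set G}) & (B : {set G})].

Lemma disjoint_sat x y :
  x \in (B : {set G}) -> proj A x = proj A y -> y \in (B : {set G}).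
Proof.
move=> xB /block_eq[<-//|[xA _]].
by move/pred0P/(_ x): AB; rewrite /= xA xB.
Qed.

Lemma disjoint_restr_subproof x y :
  quot_restr disjoint_sat x = quot_restr disjoint_sat y <->
  quot_id (restr B) x = quot_id (restr B) y.
Proof.
rewrite /= !ffunE; split=> [/(congr1 val)|->//].
move=> /block_eq[|[xA _]]; first exact: val_inj.
by move/pred0P/(_ (val x)): AB; rewrite /= xA (valP x).
Qed.

(* [{x} |-> x] *)
Definition disjoint_restr : giso (restr (tube_proj A B)) (restr B) :=
  quot_iso disjoint_restr_subproof.

Lemma disjoint_blockE x y :
  proj (tube_proj A B) (proj A x) = proj (tube_proj A B) (proj A y) <->
  [\/ x = y, x \in (A : {set G}) /\ y \in (A : {set G})
    | x \in (B : {set G}) /\ y \in (B : {set G})].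
Proof.
have inB z : (proj A z \in (tube_proj A B : {set _})) = (z \in (B : {set G})).
  apply/imsetP/idP=> [[w wB] /esym|zB]; first exact: disjoint_sat.
  by exists z.
apply: (iff_trans (block_eq (tube_proj A B) _ _)); rewrite !inB.
split=> [[/block_eq[xy|xyA]|xyB]|[->|xyA|xyB]].
- exact: Or31.
- exact: Or32.
- exact: Or33.
- by left.
- by left; apply/block_eq; right.
- by right.
Qed.

End DisjointTubes.

Lemma disjointC (G : graph) (A B : {set G}) :
  [disjoint A & B] -> [disjoint B & A].
Proof. by rewrite disjoint_sym. Qed.

Section DisjointContr.
Variables (G : cgraph) (A B : tube G).
Hypothesis AB : [disjoint (A : {set G}) & (B : {set G})].

Lemma disjoint_contr_subproof x y :
  quot_comp (proj (tube_proj A B)) (proj A) x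
  = quot_comp (proj (tube_proj A B)) (proj A) y <->
  quot_comp (proj (tube_proj B A)) (proj B) x
  = quot_comp (proj (tube_proj B A)) (proj B) y.
Proof.
apply: (iff_trans (disjoint_blockE AB x y)).
apply: iff_sym; apply: (iff_trans (disjoint_blockE (disjointC AB) x y)).
by split=> -[xy|xy|xy]; [apply: Or31 | apply: Or33 | apply: Or32
                       | apply: Or31 | apply: Or33 | apply: Or32].
Qed.

(* [(G/A)/B = (G/B)/A], both being quotients of [G] with the same fibres. *)
Definition disjoint_contr :
    giso (contr (tube_proj A B)) (contr (tube_proj B A)) :=
  quot_iso disjoint_contr_subproof.

End DisjointContr.

Section NestedTubes.
Variables (G : cgraph) (A B : tube G).
Hypothesis AB : (A : {set G}) \subset (B : {set G}).

Definition nested_set : {set restr B} := [set x | val x \in (A : {set G})].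

Lemma nested_tube_subproof : is_tube nested_set.
Proof.
have /tubeP[[x0 x0A] cA] := tsetP A.
apply/tubeP; split.
  by exists (exist _ x0 (subsetP AB _ x0A)); rewrite inE.
move=> S [x xA xS] clS y yA.
have : val y \in [set val z | z in S].
  apply: cA; last by rewrite inE in yA.
    by exists (val x); [rewrite inE in xA | apply: imset_f].
  move=> u v uA vA /imsetP[z zS uz] uv; apply/imsetP.
  exists (exist _ v (subsetP AB _ vA)) => //.
  by apply: (clS z) => //; rewrite ?inE -?uz // /adj/= /ind_adj -uz.
by case/imsetP=> z zS /val_inj->.
Qed.

Definition nested_tube : tube (restr B) := Tube nested_tube_subproof.

Lemma nested_sat x y :
  x \in (B : {set G}) -> proj A x = proj A y -> y \in (B : {set G}).
Proof. by move=> xB /block_eq[<-//|[_ yA]]; apply: (subsetP AB). Qed.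

Lemma nested_contr_subproof x y :
  quot_comp (proj (tube_proj A B)) (proj A) x
  = quot_comp (proj (tube_proj A B)) (proj A) y <-> proj B x = proj B y.
Proof.
have inB z : (proj A z \in (tube_proj A B : {set _})) = (z \in (B : {set G})).
  apply/imsetP/idP=> [[w wB] /esym|zB]; first exact: nested_sat.
  by exists z.
apply: (iff_trans (block_eq (tube_proj A B) _ _)); rewrite !inB.
apply: iff_sym; apply: (iff_trans (block_eq B _ _)).
split=> [[->|xyB]|[/block_eq[->|[xA yA]]|xyB]]; [by left|by right|by left| |by right].
by right; split; apply: (subsetP AB).
Qed.

(* [(G/A)/(B/A) = G/B] *)
Definition nested_contr : giso (contr (tube_proj A B)) (contr B) :=
  quot_iso nested_contr_subproof.

Lemma nested_restr_subproof (x y : restr B) :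
  quot_restr nested_sat x = quot_restr nested_sat y <->
  proj nested_tube x = proj nested_tube y.
Proof.
apply: iff_sym; apply: (iff_trans (block_eq nested_tube x y)); rewrite !inE.
split=> [[->//|?]|/(congr1 val)/block_eq[/val_inj|]]; [|by left|by right].
by apply: val_inj; apply/block_eq; right.
Qed.

(* [(G/A)|(B/A) = (G|B)/A] *)
Definition nested_restr : giso (restr (tube_proj A B)) (contr nested_tube) :=
  quot_iso nested_restr_subproof.

Lemma nested_restr2_in (x : restr nested_tube) :
  val (val x) \in (A : {set G}).
Proof. by have := valP x; rewrite inE. Qed.

(* [(G|B)|A = G|A] *)
Definition nested_restr2 : giso (restr nested_tube) (restr A).
Proof.
apply: (@giso_mk (restr nested_tube) (restr A)
                 (fun x => exist _ (val (val x)) (nested_restr2_in x)))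
  => [x y /(congr1 val) /= e | y | x y //].
  by do 2!apply: val_inj.
have yB : val y \in (B : {set G}) by apply: (subsetP AB) (valP y).
have yA : exist _ (val y) yB \in nested_set by rewrite inE (valP y).
by exists (exist _ (exist _ (val y) yB) yA); apply: val_inj.
Defined.

End NestedTubes.

Record graphColl (C : symMonCat) := GraphColl {
  gob :> cgraph -> C;
  gmap : forall G H : cgraph, giso G H -> Hom (gob H) (gob G);
  gmap1 : forall G : cgraph, gmap (giso_id G) = idm (gob G);
  gmapM : forall (G H K : cgraph) (g : giso H K) (f : giso G H),
    gmap (giso_comp g f) = gmap f \c gmap g
}.
Arguments gmap {C} _ {G H}.

(* The axioms of a contractad, read after identifying the canonically isomorphic
   iterated contractions and restrictions:
     ccomp_unitr  l o_{v} Id = l            ccomp_unitl  Id o_V l = l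
     ccomp_par    (l o_A2 n2) o_A1 n1 = (l o_A1 n1) o_A2 n2
     ccomp_seq    l o_B (m o_A n) = (l o_{B/A} m) o_A n.
   In ccomp_par, [l] lives in [(G/A1)/A2], and in ccomp_seq, [l], [m], [n] live
   in [G/B], [(G|B)/A], [G|A]. *)
Record contractad (C : symMonCat) := Contractad {
  coll :> graphColl C;
  cunit : Hom unitO (coll P1);
  ccomp : forall (G : cgraph) (A : tube G),
    Hom (coll (contr A) \ox coll (restr A)) (coll G);
  ccomp_nat : forall (G H : cgraph) (f : giso G H) (A : tube G),
    gmap coll f \c ccomp (giso_tube f A)
    = ccomp A \c (gmap coll (contr_giso f A) \om gmap coll (restr_giso f A));
  ccomp_unitr : forall (G : cgraph) (v : G),
    ccomp (tube1 v)
      \c (gmap coll (contr_tube1 v) \om (gmap coll (restr_tube1 v) \c cunit))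
    = runit (coll G);
  ccomp_unitl : forall G : cgraph,
    ccomp (tubeT G)
      \c ((gmap coll (contr_tubeT G) \c cunit) \om gmap coll (restr_tubeT G))
    = lunit (coll G);
  ccomp_par : forall (G : cgraph) (A1 A2 : tube G)
      (A12 : [disjoint (A1 : {set G}) & (A2 : {set G})]),
    ccomp A1
      \c ((ccomp (tube_proj A1 A2) \c (idm _ \om gmap coll (disjoint_restr A12)))
          \om idm (coll (restr A1)))
    = ccomp A2
      \c ((ccomp (tube_proj A2 A1)
           \c (gmap coll (disjoint_contr (disjointC A12))
               \om gmap coll (disjoint_restr (disjointC A12))))
          \om idm (coll (restr A2)))
      \c swap23 (coll (contr (tube_proj A1 A2))) (coll (restr A2))
                (coll (restr A1));
  ccomp_seq : forall (G : cgraph) (A B : tube G)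
      (AB : (A : {set G}) \subset (B : {set G})),
    ccomp B
      \c (idm (coll (contr B))
          \om (ccomp (nested_tube AB) \c (idm _ \om gmap coll (nested_restr2 AB))))
    = ccomp A
      \c ((ccomp (tube_proj A B)
           \c (gmap coll (nested_contr AB) \om gmap coll (nested_restr AB)))
          \om idm (coll (restr A)))
      \c assocV (coll (contr B)) (coll (contr (nested_tube AB))) (coll (restr A))
}.
Arguments cunit {C} _.
Arguments ccomp {C} _ {G} A.

(* [smob M n] is the component of arity [n.+1].  In MathComp [(s * t)%g] is
   [t \o s], so [smactM] reads [l.(t \o s) = (l.t).s], a right action. *)
Record sigmaModule (C : symMonCat) := SigmaModule {
  smob :> nat -> C;
  smact : forall n, 'S_n.+1 -> Hom (smob n) (smob n);
  smact1 : forall n, smact (1 : 'S_n.+1)%g = idm (smob n);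
  smactM : forall n (s t : 'S_n.+1), smact (s * t)%g = smact s \c smact t
}.
Arguments smact {C} _ {n}.

Definition smcast (C : symMonCat) (M : nat -> C) (m n : nat) (e : m = n) :
    Hom (M m) (M n) :=
  match e in _ = k return Hom (M m) (M k) with erefl => idm (M m) end.

Section Insertion.
Variables (a b : nat).

(* The monotone map collapsing [i, ..., i + b] to [i]. *)
Definition collapse (i : 'I_a.+1) (x : 'I_(a + b).+1) : 'I_a.+1 :=
  inord (if x < i then x : nat else if x <= i + b then i : nat else x - b).

Lemma collapseE i x :
  collapse i x =
    (if x < i then x : nat else if x <= i + b then i : nat else x - b) :> nat.
Proof.
rewrite inordK //; have ? := ltn_ord i; have ? := ltn_ord x.
by case: ifP => ?; [|case: ifP]; lia.
Qed.

(* The block permutation of [a + b + 1] letters obtained from [s] by replacing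
   the letter [i] by a block of [b + 1] letters permuted by [t]. *)
Definition insert_fun (i : 'I_a.+1) (s : 'S_a.+1) (t : 'S_b.+1)
    (x : 'I_(a + b).+1) : 'I_(a + b).+1 :=
  if i <= x <= i + b then inord (s i + t (inord (x - i)))
  else let y := s (collapse i x) in inord (if y < s i then y : nat else y + b).

Lemma insert_funE i s t x :
  insert_fun i s t x =
    (if i <= x <= i + b then s i + t (inord (x - i))
     else let y := s (collapse i x) in if y < s i then y : nat else y + b) :> nat.
Proof.
rewrite /insert_fun; case: ifP => _ /=; rewrite inordK //.
  by have := ltn_ord (s i); have := ltn_ord (t (inord (x - i))); lia.
have ? := ltn_ord (s i); have ? := ltn_ord (s (collapse i x)).
by case: ifP; lia.
Qed.

Lemma insert_fun_inj i s t : injective (insert_fun i s t).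
Proof.
have sne (x : 'I_(a + b).+1) : ~~ (i <= x <= i + b) -> s (collapse i x) <> s i :> nat.
  move=> xi /val_inj/perm_inj/(congr1 val)/=; rewrite collapseE.
  by case: ifP => ?; [|case: ifP => ?]; lia.
move=> x y /(congr1 val)/=; rewrite !insert_funE.
have [xi|xi] := boolP (i <= x <= i + b); have [yi|yi] := boolP (i <= y <= i + b).
- move/addnI/val_inj/perm_inj/(congr1 val); rewrite /= !inordK; try lia.
  by move=> e; apply: val_inj => /=; lia.
- have := sne y yi; have := ltn_ord (t (inord (x - i))).
  by move=> /= ? ?; case: ifP => ?; lia.
- have := sne x xi; have := ltn_ord (t (inord (y - i))).
  by move=> /= ? ?; case: ifP => ?; lia.
- move=> /= e; have exy : s (collapse i x) = s (collapse i y).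
    apply: val_inj => /=; have := sne x xi; have := sne y yi.
    by move: e; case: ifP => ?; case: ifP => ? ? ? ?; lia.
  apply: val_inj; move/perm_inj/(congr1 val): exy; rewrite /= !collapseE.
  by move: xi yi; do !case: ifP => //=; lia.
Qed.

Definition insert_perm (i : 'I_a.+1) (s : 'S_a.+1) (t : 'S_b.+1) :
    'S_(a + b).+1 := perm (@insert_fun_inj i s t).

End Insertion.

(* Positions [i : 'I_a.+1] are counted from [0]; [i] and [k + b] below are
   positions in arity [(a + b).+1]. *)
Record operad (C : symMonCat) (M : sigmaModule C) := Operad {
  ounit : Hom unitO (M 0);
  ocirc : forall a b, 'I_a.+1 -> Hom (M a \ox M b) (M (a + b));
  ocirc_unitr : forall a (i : 'I_a.+1),
    smcast M (addn0 a) \c ocirc 0 i \c (idm (M a) \om ounit) = runit (M a);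
  ocirc_unitl : forall b,
    smcast M (add0n b) \c ocirc b (ord0 : 'I_1) \c (ounit \om idm (M b))
    = lunit (M b);
  ocirc_seq : forall a b c (i : 'I_a.+1) (j : 'I_b.+1),
    smcast M (addnA a b c) \c ocirc (b + c) i \c (idm (M a) \om ocirc c j)
    = ocirc c (inord (i + j) : 'I_(a + b).+1) \c (ocirc b i \om idm (M c))
      \c assocV (M a) (M b) (M c);
  ocirc_par : forall a b c (i k : 'I_a.+1), i < k ->
    smcast M (addnAC a b c)
      \c ocirc c (inord (k + b) : 'I_(a + b).+1) \c (ocirc b i \om idm (M c))
    = ocirc b (inord i : 'I_(a + c).+1) \c (ocirc c k \om idm (M b))
      \c swap23 (M a) (M b) (M c);
  ocirc_equiv : forall a b (i : 'I_a.+1) (s : 'S_a.+1) (t : 'S_b.+1),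
    ocirc b i \c (smact M s \om smact M t)
    = smact M (insert_perm i s t) \c ocirc b (s i)
}.
Arguments ounit {C M} _.
Arguments ocirc {C M} _ {a} b i.

Section PermIso.
Variables (n : nat) (s : 'S_n.+1).

Lemma complete_perm_surj (y : complete n) : exists x : complete n, s x = y.
Proof. by exists ((s^-1)%g y); rewrite permKV. Qed.

Lemma complete_perm_adj (x y : complete n) :
  adj (s x : complete n) (s y : complete n) = adj x y.
Proof. by congr (~~ _); rewrite (inj_eq perm_inj). Qed.

Definition complete_perm : giso (complete n) (complete n) :=
  @giso_mk (complete n) (complete n) s (@perm_inj _ s) complete_perm_surj complete_perm_adj.

End PermIso.

Section CompleteTube.
Variables (a b : nat) (i : 'I_a.+1).

Definition interval : {set complete (a + b)} :=
  [set x : 'I_(a + b).+1 | i <= x <= i + b].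

Lemma interval_neq0 : interval != set0.
Proof.
apply/set0Pn; exists (inord i); rewrite inE inordK; have := ltn_ord i; lia.
Qed.

Definition interval_tube : tube (complete (a + b)) :=
  Tube (complete_tube interval_neq0).

Lemma collapse_surj (y : complete a) :
  [exists x : complete (a + b), (collapse i x : complete a) == y].
Proof.
apply/existsP; exists (inord (if y <= i then y : nat else y + b)).
rewrite -val_eqE /= collapseE inordK; have := ltn_ord (y : 'I_a.+1);
  have := ltn_ord i; do !case: ifP => //=; lia.
Qed.

Lemma collapse_adj (y z : complete a) :
  adj y z = (y != z) && [exists u : complete (a + b), exists v : complete (a + b),
    [&& (collapse i u : complete a) == y, (collapse i v : complete a) == z
      & adj u v]].
Proof.
change (adj y z) with (y != z); case: eqVneq => //= yz; apply/esym.
have /existsP[u /eqP uy] := collapse_surj y.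
have /existsP[v /eqP vz] := collapse_surj z.
apply/existsP; exists u; apply/existsP; exists v; rewrite uy vz !eqxx /=.
by change (u != v); apply: contraNneq yz => e; rewrite -uy -vz e.
Qed.

Definition quot_collapse : quot (complete (a + b)) (complete a) :=
  Quot collapse_surj collapse_adj.

Lemma complete_contr_subproof x y :
  proj interval_tube x = proj interval_tube y <->
  quot_collapse x = quot_collapse y.
Proof.
apply: (iff_trans (block_eq interval_tube x y)); rewrite !inE /=.
split=> [[->//|[xi yi]]|/(congr1 val)/=].
  by apply: val_inj; rewrite /= !collapseE; do !case: ifP => //=; lia.
rewrite !collapseE => e.
have [xi|xi] := boolP (i <= x <= i + b); have [yi|yi] := boolP (i <= y <= i + b);
  (try by right); left; apply: val_inj => /=;
  by move: e xi yi; do !case: ifP => //=; lia.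
Qed.

(* The relabelling of the blocks ordered by minimal elements: [block x] goes to
   [collapse i x], which is monotone in [x]. *)
Definition complete_contr : giso (contr interval_tube) (complete a) :=
  quot_iso complete_contr_subproof.

Lemma complete_contr_mono (x y : 'I_(a + b).+1) : x <= y ->
  (complete_contr (proj interval_tube x) : 'I_a.+1)
  <= (complete_contr (proj interval_tube y) : 'I_a.+1).
Proof.
rewrite !quot_isoE /= !collapseE => xy.
by do !case: ifP => //=; lia.
Qed.

Lemma complete_restr_inj :
  injective (fun x : restr interval_tube => inord (val x - i) : complete b).
Proof.
move=> x y /(congr1 val); have := valP x; have := valP y; rewrite !inE /=.
by move=> yi xi; rewrite !inordK => [e||]; first (do 2!apply: val_inj => /=); lia.
Qed.

Lemma complete_restr_surj (y : complete b) :
  exists x : restr interval_tube, inord (val x - i) = y.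
Proof.
have yi : inord (i + y) \in interval.
  rewrite inE inordK; have := ltn_ord (y : 'I_b.+1); have := ltn_ord i; lia.
exists (exist (fun z : complete (a + b) => z \in interval) _ yi).
apply: val_inj => /=.
have := ltn_ord (y : 'I_b.+1); have := ltn_ord i => ? ?.
by rewrite !inordK; lia.
Qed.

Lemma complete_restr_adj (x y : restr interval_tube) :
  adj (inord (val x - i) : complete b) (inord (val y - i) : complete b) = adj x y.
Proof.
by congr (~~ _); rewrite (inj_eq complete_restr_inj).
Qed.

Definition complete_restr : giso (restr interval_tube) (complete b) :=
  giso_mk complete_restr_inj complete_restr_surj complete_restr_adj.

End CompleteTube.

Section Kstar.
Variables (C : symMonCat) (P : contractad C).

Definition Kact n (s : 'S_n.+1) : Hom (P (complete n)) (P (complete n)) :=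
  gmap P (complete_perm s).

Lemma Kact1 n : Kact (1 : 'S_n.+1)%g = idm (P (complete n)).
Proof.
rewrite /Kact -gmap1; congr (gmap P _).
by apply: giso_eq => x; rewrite !ffunE perm1.
Qed.

Lemma KactM n (s t : 'S_n.+1) : Kact (s * t)%g = Kact s \c Kact t.
Proof.
rewrite /Kact -gmapM; congr (gmap P _).
by apply: giso_eq => x; rewrite !ffunE permM.
Qed.

Definition Kstar : sigmaModule C :=
  SigmaModule (smob := fun n => P (complete n)) Kact1 KactM.

Definition Kcirc a b (i : 'I_a.+1) : Hom (Kstar a \ox Kstar b) (Kstar (a + b)) :=
  ccomp P (interval_tube b i)
    \c (gmap P (complete_contr b i) \om gmap P (complete_restr b i)).

End Kstar.

(* Main.v *)
(* Identify G/A and G|A with prescribed graphs along arbitrary isomorphisms.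
   Naturality under isomorphisms then turns each contractad axiom into an
   identity between such relabelled compositions whose hypotheses only compare
   images of vertices. For intervals in complete graphs these hypotheses are
   inequalities between integers, and they give the operad axioms. *)

Require Import Defs.
From mathcomp Require Import all_boot perm zify.

Set Implicit Arguments.
Unset Strict Implicit.
Unset Printing Implicit Defensive.

Local Open Scope smc_scope.

(** * Naturality of the inverse associator and of the exchange of the last two factors *)

Section SymMonCatLemmas.
Variable C : symMonCat.

Lemma assocV_nat (A A' B B' D D' : C) (f : Hom A A') (g : Hom B B')
    (h : Hom D D') :
  assocV A' B' D' \c (f \om (g \om h)) = ((f \om g) \om h) \c assocV A B D.
Proof.
rewrite -[LHS]cmpm1 -(assocVK A B D) cmpA -[_ \c (f \om _) \c _]cmpA.
by rewrite -assoc_nat !cmpA assocK cmp1m.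
Qed.

Lemma swap23_nat (A A' B B' D D' : C) (f : Hom A A') (g : Hom B B')
    (h : Hom D D') :
  swap23 A' B' D' \c ((f \om g) \om h) = ((f \om h) \om g) \c swap23 A B D.
Proof.
rewrite /swap23 -!cmpA assoc_nat !cmpA -[_ \c _ \c (f \om _)]cmpA.
rewrite -tensmM braid_nat cmp1m -[f in f \om (_ \c _)]cmpm1 tensmM.
by rewrite !cmpA assocV_nat.
Qed.

End SymMonCatLemmas.

Lemma tube_eq (G : graph) (A B : tube G) : (A : {set G}) =i B -> A = B.
Proof.
case: A B => A AP [B BP] /= /setP AB.
by move: AP BP; rewrite AB => p q; rewrite (bool_irrelevance p q).
Qed.

(** * Contractad axioms for compositions relabelled along isomorphisms *)

Section Composition.
Variables (C : symMonCat) (P : contractad C).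

Lemma gmap_comp_eq (G H K : cgraph) (h : giso G K) (g : giso H K)
    (f : giso G H) :
  (forall x, h x = g (f x)) -> gmap P h = gmap P f \c gmap P g.
Proof.
move=> hgf; rewrite -gmapM; congr (gmap P _).
by apply: giso_eq => x; rewrite hgf ffunE.
Qed.

(** [Kcirc] is the instance with [complete_contr] and [complete_restr]. *)
Definition gcomp (G : cgraph) (A : tube G) (X Y : cgraph)
    (c : giso (contr A) X) (r : giso (restr A) Y) : Hom (P X \ox P Y) (P G) :=
  ccomp P A \c (gmap P c \om gmap P r).

(** The membership hypothesis forces [B] to be [giso_tube f A], and substituting it makes
    [ccomp_nat] applicable without a transport. The new relabellings are kept existential: their
    values on vertices are all that is used afterwards. *)
Lemma gmap_gcomp (G H : cgraph) (f : giso G H) (A : tube G) (B : tube H)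
    (X Y : cgraph) (c : giso (contr B) X) (r : giso (restr B) Y) :
    (forall x, (f x \in (B : {set H})) = (x \in (A : {set G}))) ->
  exists (c' : giso (contr A) X) (r' : giso (restr A) Y),
    [/\ gmap P f \c gcomp c r = gcomp c' r',
        forall x, c' (proj A x) = c (proj B (f x))
      & forall (x : restr A) (y : restr B), val y = f (val x) -> r' x = r y].
Proof.
move=> fAB; have eB : B = giso_tube f A.
  apply: tube_eq => y; have /existsP[x /eqP<-] := giso_surj f y.
  by rewrite fAB /= (mem_imset _ _ (@giso_inj _ _ f)).
subst B; exists (giso_comp c (contr_giso f A)), (giso_comp r (restr_giso f A)).
split.
- by rewrite /gcomp cmpA ccomp_nat -cmpA -tensmM -!gmapM.
- by move=> x; rewrite ffunE quot_isoE.
- move=> x y yx; rewrite ffunE; congr (r _).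
  have := quot_isoE (@restr_giso_subproof2 _ _ f A) x.
  by rewrite [quot_id _ x]ffunE /restr_giso => ->; apply: val_inj.
Qed.

(** As [restr A] is isomorphic to the one-vertex graph, [A] is a singleton and [ccomp_unitr]
    applies. Any two maps into [P1] agree, so only [c] has to be compared. *)
Lemma gcomp_unitr (G : cgraph) (A : tube G) (X : cgraph)
    (c : giso (contr A) X) (r : giso (restr A) P1) (f : giso G X) :
    (forall x, c (proj A x) = f x) ->
  gcomp c r \c (idm (P X) \om cunit P) = gmap P f \c runit (P X).
Proof.
move=> cf; have /existsP[v _] := giso_surj r ord0.
have eA : A = tube1 (val v).
  apply: tube_eq => x; rewrite inE; apply/idP/eqP => [xA | ->]; last exact: valP.
  rewrite -[x]/(val (exist (fun x => x \in (A : {set G})) x xA)).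
  by congr (val _); apply: (@giso_inj _ _ r); rewrite (ord1 (r v)) ord1.
(* The type of [v] mentions [A]; generalizing its underlying vertex allows the substitution. *)
move: (val v) eA => {}v eA; subst A.
rewrite -runit_nat -(ccomp_unitr P v) /gcomp -!cmpA -!tensmM !cmpm1.
have -> : r = restr_tube1 v by apply: giso_eq => x; rewrite (ord1 (r x)) ord1.
congr (_ \c (_ \om _)).
apply: gmap_comp_eq => B; have /existsP[x /eqP<-] := block_surj B.
have := quot_isoE (@contr_tube1_subproof _ v) x.
by rewrite [quot_id _ x]ffunE /contr_tube1 => ->; apply: cf.
Qed.

(** The contraction has a single block, so every vertex shares the block of some element of [A];
    hence [A] is the whole vertex set and [ccomp_unitl] applies. *)
Lemma gcomp_unitl (G : cgraph) (A : tube G) (Y : cgraph)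
    (c : giso (contr A) P1) (r : giso (restr A) Y) (f : giso G Y) :
    (forall x, r x = f (val x)) ->
  gcomp c r \c (cunit P \om idm (P Y)) = gmap P f \c lunit (P Y).
Proof.
move=> rf; have eA : A = tubeT G.
  have /tubeP[[v vA] _] := tsetP A.
  apply: tube_eq => x; rewrite [RHS]inE.
  have /(giso_inj (f := c))/block_eq[<-//|[]//] : c (proj A v) = c (proj A x).
  by rewrite (ord1 (c (proj A v))) ord1.
subst A; rewrite -lunit_nat -ccomp_unitl /gcomp -!cmpA -!tensmM !cmpm1.
have -> : c = contr_tubeT G by apply: giso_eq => x; rewrite (ord1 (c x)) ord1.
congr (_ \c (_ \om _)).
by apply: gmap_comp_eq => x; rewrite rf ffunE.
Qed.

(** Here [A'] plays the role of [A] inside the restriction to [B], and [B'] that of [B/A].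
    Naturality moves both inner compositions to these canonical tubes, where [ccomp_seq] holds; the
    last three hypotheses match the relabellings. *)
Lemma gcomp_seq (G : cgraph) (A B : tube G) (X Y Z U W : cgraph)
    (cB : giso (contr B) X) (rB : giso (restr B) Y)
    (A' : tube Y) (cA' : giso (contr A') Z) (rA' : giso (restr A') W)
    (cA : giso (contr A) U) (rA : giso (restr A) W)
    (B' : tube U) (cB' : giso (contr B') X) (rB' : giso (restr B') Z) :
    (A : {set G}) \subset (B : {set G}) ->
    (forall x : restr B,
       (rB x \in (A' : {set Y})) = (val x \in (A : {set G}))) ->
    (forall x, (cA (proj A x) \in (B' : {set U})) = (x \in (B : {set G}))) ->
    (forall x, cB' (proj B' (cA (proj A x))) = cB (proj B x)) ->
    (forall (x : restr B) (y : restr B'), val y = cA (proj A (val x)) ->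
       rB' y = cA' (proj A' (rB x))) ->
    (forall (x : restr A) (y : restr B) (z : restr A'),
       val y = val x -> val z = rB y -> rA' z = rA x) ->
  gcomp cB rB \c (idm (P X) \om gcomp cA' rA')
  = gcomp cA rA \c (gcomp cB' rB' \om idm (P W)) \c assocV (P X) (P Z) (P W).
Proof.
move=> AB AA' BB' cBE rBE rAE.
have [|c2 [r2 [e2 c2E r2E]]] :=
  @gmap_gcomp (restr B) Y rB (nested_tube AB) A' Z W cA' rA'.
  by move=> x; rewrite AA' inE.
have [|c3 [r3 [e3 c3E r3E]]] :=
  @gmap_gcomp (contr A) U cA (tube_proj A B) B' X Z cB' rB'.
  move=> b; have /existsP[x /eqP<-] := block_surj b; rewrite BB'.
  apply/idP/imsetP=> [xB|[y yB] /esym]; [by exists x | exact: (nested_sat AB)].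
rewrite /(gcomp cB) /(gcomp cA) -!cmpA -tensmM cmpm1 e2.
rewrite [(_ \om _) \c (_ \c _)]cmpA -tensmM cmpm1 e3.
(* The pulled-back [r2] factors as [nested_restr2] followed by [rA]. *)
have -> : gcomp c2 r2
    = ccomp P (nested_tube AB) \c (idm _ \om gmap P (nested_restr2 AB))
      \c (gmap P c2 \om gmap P rA).
  rewrite /gcomp -cmpA -tensmM cmp1m; congr (_ \c (_ \om _)).
  apply: gmap_comp_eq => x.
  have rxA' : rB (val x) \in (A' : {set Y}).
    by rewrite AA' (nested_restr2_in x).
  pose z : restr A' := exist (fun y => y \in (A' : {set Y})) (rB (val x)) rxA'.
  rewrite (r2E x z) // ffunE; exact: rAE.
(* Likewise [c3] is [nested_contr] followed by [cB], and [r3] is [nested_restr] followed by [c2]. *)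
have -> : gcomp c3 r3
    = ccomp P (tube_proj A B)
      \c (gmap P (nested_contr AB) \om gmap P (nested_restr AB))
      \c (gmap P cB \om gmap P c2).
  rewrite /gcomp -cmpA -tensmM; congr (_ \c (_ \om _)).
    apply: gmap_comp_eq => b; have /existsP[b' /eqP<-] := block_surj b.
    have /existsP[x /eqP<-] := block_surj b'.
    have := quot_isoE (nested_contr_subproof AB) x.
    by rewrite c3E cBE /nested_contr => ->.
  apply: gmap_comp_eq => b.
  have /existsP[x /eqP<-] := quot_surj (quot_restr (nested_sat AB)) b.
  have := quot_isoE (nested_restr_subproof AB) x.
  rewrite /nested_restr => ->; rewrite c2E.
  have xB' : cA (proj A (val x)) \in (B' : {set U}) by rewrite BB' (valP x).
  pose y : restr B' := exist (fun y => y \in (B' : {set U})) _ xB'.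
  rewrite (r3E _ y) //; exact: rBE.
(* Both sides are now a side of [ccomp_seq] composed with the common relabelling by [cB], [c2] and
   [rA]. *)
transitivity (ccomp P B \c (idm (P (contr B))
          \om (ccomp P (nested_tube AB) \c (idm _ \om gmap P (nested_restr2 AB))))
   \c (gmap P cB \om (gmap P c2 \om gmap P rA))).
  by rewrite -[in RHS]cmpA -tensmM cmp1m.
rewrite ccomp_seq -!cmpA assocV_nat.
rewrite [(_ \om idm _) \c (_ \c _)]cmpA -tensmM cmp1m.
by rewrite [in RHS](cmpA (ccomp P (tube_proj A B))).
Qed.

(** Same method as for nested tubes, with [A'] and [B'] the images of [A] and [B] after contracting
    the other one. Since [ccomp_par] reads the outer argument in [(G/A)/B], [c3] is the common
    relabelling and [c2] is rewritten as [disjoint_contr] followed by [c3]. *)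
Lemma gcomp_par (G : cgraph) (A B : tube G) (X Y Z U V : cgraph)
    (cA : giso (contr A) U) (rA : giso (restr A) Y)
    (cB : giso (contr B) V) (rB : giso (restr B) Z)
    (A' : tube V) (cA' : giso (contr A') X) (rA' : giso (restr A') Y)
    (B' : tube U) (cB' : giso (contr B') X) (rB' : giso (restr B') Z) :
    [disjoint (A : {set G}) & (B : {set G})] ->
    (forall x, (cB (proj B x) \in (A' : {set V})) = (x \in (A : {set G}))) ->
    (forall x, (cA (proj A x) \in (B' : {set U})) = (x \in (B : {set G}))) ->
    (forall x, cB' (proj B' (cA (proj A x))) = cA' (proj A' (cB (proj B x)))) ->
    (forall (x : restr A) (y : restr A'), val y = cB (proj B (val x)) ->
       rA' y = rA x) ->
    (forall (x : restr B) (y : restr B'), val y = cA (proj A (val x)) ->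
       rB' y = rB x) ->
  gcomp cA rA \c (gcomp cB' rB' \om idm (P Y))
  = gcomp cB rB \c (gcomp cA' rA' \om idm (P Z))
    \c swap23 (P X) (P Z) (P Y).
Proof.
move=> AB AA' BB' cE rAE rBE; pose BA := disjointC AB.
have [|c2 [r2 [e2 c2E r2E]]] :=
  @gmap_gcomp (contr B) V cB (tube_proj B A) A' X Y cA' rA'.
  move=> b; have /existsP[x /eqP<-] := block_surj b; rewrite AA'.
  apply/idP/imsetP=> [xB|[y yB] /esym]; [by exists x | exact: (disjoint_sat BA)].
have [|c3 [r3 [e3 c3E r3E]]] :=
  @gmap_gcomp (contr A) U cA (tube_proj A B) B' X Z cB' rB'.
  move=> b; have /existsP[x /eqP<-] := block_surj b; rewrite BB'.
  apply/idP/imsetP=> [xB|[y yB] /esym]; [by exists x | exact: (disjoint_sat AB)].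
rewrite /(gcomp cB) /(gcomp cA) -!cmpA -tensmM cmpm1 e3.
rewrite [(_ \om _) \c (_ \c _)]cmpA -tensmM cmpm1 e2.
have -> : gcomp c3 r3
    = ccomp P (tube_proj A B) \c (idm _ \om gmap P (disjoint_restr AB))
      \c (gmap P c3 \om gmap P rB).
  rewrite /gcomp -cmpA -tensmM cmp1m; congr (_ \c (_ \om _)).
  apply: gmap_comp_eq => b.
  have /existsP[x /eqP<-] := quot_surj (quot_restr (disjoint_sat AB)) b.
  have := quot_isoE (disjoint_restr_subproof AB) x.
  rewrite [quot_id _ x]ffunE /disjoint_restr => ->.
  have xB' : cA (proj A (val x)) \in (B' : {set U}) by rewrite BB' (valP x).
  pose y : restr B' := exist (fun y => y \in (B' : {set U})) _ xB'.
  rewrite (r3E _ y) //; exact: rBE.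
have -> : gcomp c2 r2
    = ccomp P (tube_proj B A)
      \c (gmap P (disjoint_contr BA) \om gmap P (disjoint_restr BA))
      \c (gmap P c3 \om gmap P rA).
  rewrite /gcomp -cmpA -tensmM; congr (_ \c (_ \om _)).
    apply: gmap_comp_eq => b; have /existsP[b' /eqP<-] := block_surj b.
    have /existsP[x /eqP<-] := block_surj b'.
    have := quot_isoE (disjoint_contr_subproof BA) x.
    rewrite c2E /disjoint_contr => ->.
    by rewrite c3E cE.
  apply: gmap_comp_eq => b.
  have /existsP[x /eqP<-] := quot_surj (quot_restr (disjoint_sat BA)) b.
  have := quot_isoE (disjoint_restr_subproof BA) x.
  rewrite [quot_id _ x]ffunE /disjoint_restr => ->.
  have xA' : cB (proj B (val x)) \in (A' : {set V}) by rewrite AA' (valP x).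
  pose y : restr A' := exist (fun y => y \in (A' : {set V})) _ xA'.
  rewrite (r2E _ y) //; exact: rAE.
transitivity (ccomp P A
    \c ((ccomp P (tube_proj A B) \c (idm _ \om gmap P (disjoint_restr AB)))
        \om idm (P (restr A)))
    \c ((gmap P c3 \om gmap P rB) \om gmap P rA)).
  by rewrite -[in RHS]cmpA -tensmM cmp1m.
rewrite (ccomp_par P AB) -[LHS]cmpA swap23_nat -!(cmpA (ccomp P B)).
by rewrite [(_ \om idm _) \c (_ \c _)]cmpA -tensmM cmp1m.
Qed.

End Composition.

(** * Interval tubes in complete graphs and the operad axioms *)

Section OperadAxioms.
Variables (C : symMonCat) (P : contractad C).

(** With the target arity a variable [n], the equation [e] can be eliminated and the cast becomes an
    identity. The tube and its relabellings are then described by integer formulas in which [e] does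
    not occur. *)
Lemma smcast_Kcirc a b n (e : a + b = n) (i : 'I_a.+1) :
  exists (A : tube (complete n)) (c : giso (contr A) (complete a))
         (r : giso (restr A) (complete b)),
    [/\ smcast (Kstar P) e \c Kcirc P b i = gcomp P c r,
        forall x : 'I_n.+1, (x \in (A : {set complete n})) = (i <= x <= i + b),
        forall x : 'I_n.+1, (c (proj A x) : 'I_a.+1)
          = (if x < i then x : nat else if x <= i + b then i : nat else x - b)
            :> nat
      & forall x : restr A, (r x : 'I_b.+1) = val x - i :> nat].
Proof.
case: n / e; exists (interval_tube b i), (complete_contr b i), (complete_restr b i).
split.
- by rewrite cmp1m.
- by move=> x; rewrite inE.
- move=> x; rewrite -(collapseE i x) /complete_contr.
  by rewrite (quot_isoE (@complete_contr_subproof _ _ i)).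
- move=> x; rewrite ffunE inordK //.
  by have := valP x; rewrite inE /=; lia.
Qed.

Lemma Kcirc_gcomp a b (i : 'I_a.+1) :
  exists (A : tube (complete (a + b))) (c : giso (contr A) (complete a))
         (r : giso (restr A) (complete b)),
    [/\ Kcirc P b i = gcomp P c r,
        forall x : 'I_(a + b).+1,
          (x \in (A : {set complete (a + b)})) = (i <= x <= i + b),
        forall x : 'I_(a + b).+1, (c (proj A x) : 'I_a.+1)
          = (if x < i then x : nat else if x <= i + b then i : nat else x - b)
            :> nat
      & forall x : restr A, (r x : 'I_b.+1) = val x - i :> nat].
Proof.
have [A [c [r [e inA cE rE]]]] := smcast_Kcirc (erefl (a + b)) i.
by exists A, c, r; rewrite -e cmp1m.
Qed.

Lemma Kcirc_unitr a (i : 'I_a.+1) :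
  smcast (Kstar P) (addn0 a) \c Kcirc P 0 i
    \c (idm (Kstar P a) \om (cunit P : Hom unitO (Kstar P 0)))
  = runit (Kstar P a).
Proof.
have [A [c [r [-> _ cE _]]]] := smcast_Kcirc (addn0 a) i.
(* Collapsing an interval of length one moves no label, hence the identity for [f]. *)
rewrite (@gcomp_unitr _ P _ _ _ c r (giso_id _)) ?gmap1 ?cmp1m // => x.
rewrite ffunE; apply: val_inj; rewrite /= cE.
by do !case: ifP => //=; lia.
Qed.

Lemma Kcirc_unitl b :
  smcast (Kstar P) (add0n b) \c Kcirc P b (ord0 : 'I_1)
    \c ((cunit P : Hom unitO (Kstar P 0)) \om idm (Kstar P b))
  = lunit (Kstar P b).
Proof.
have [A [c [r [-> _ _ rE]]]] := smcast_Kcirc (add0n b) (ord0 : 'I_1).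
rewrite (@gcomp_unitl _ P _ _ _ c r (giso_id _)) ?gmap1 ?cmp1m // => x.
by rewrite ffunE; apply: val_inj; rewrite /= rE subn0.
Qed.

(** The nested tubes are [[i + j, i + j + c]] inside [[i, i + b + c]]. Restricting to the larger one
    shifts the smaller to [[j, j + c]]; contracting the smaller one turns the larger into
    [[i, i + b]]. *)
Lemma Kcirc_seq a b c (i : 'I_a.+1) (j : 'I_b.+1) :
  smcast (Kstar P) (addnA a b c) \c Kcirc P (b + c) i
    \c (idm (Kstar P a) \om Kcirc P c j)
  = Kcirc P c (inord (i + j) : 'I_(a + b).+1)
    \c (Kcirc P b i \om idm (Kstar P c))
    \c assocV (Kstar P a) (Kstar P b) (Kstar P c).
Proof.
have [B [cB [rB [-> inB cBE rBE]]]] := smcast_Kcirc (addnA a b c) i.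
have [A' [cA' [rA' [-> inA' cAE' rAE']]]] := Kcirc_gcomp c j.
have [A [cA [rA [-> inA cAE rAE]]]] :=
  Kcirc_gcomp c (inord (i + j) : 'I_(a + b).+1).
have [B' [cB' [rB' [-> inB' cBE' rBE']]]] := Kcirc_gcomp b i.
(* The bounds on [i] and [j] keep [inord] away from its default value 0. *)
have ij : (inord (i + j) : 'I_(a + b).+1) = i + j :> nat.
  by rewrite inordK //; have := ltn_ord i; have := ltn_ord j; lia.
have jb := ltn_ord j; rewrite ij in inA cAE rAE.
apply: gcomp_seq.
- by apply/subsetP => x; rewrite inA inB; lia.
- move=> x; have := valP x; rewrite inA' inA rBE inB /=; lia.
- by move=> x; rewrite inB' cAE inB; do !case: ifP => //=; lia.
- move=> x; apply: val_inj; rewrite /= cBE cBE' cAE.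
  by do !case: ifP => //=; lia.
(* On the larger interval, collapsing at [i + j] and then subtracting [i] agrees with subtracting
   [i] and then collapsing at [j]. *)
- move=> x y exy; apply: val_inj; rewrite /= rBE' exy cAE' cAE rBE.
  have := valP x; rewrite inB /=.
  by do !case: ifP => //=; lia.
- move=> x y z eyx ezy; apply: val_inj; rewrite /= rAE' rAE ezy rBE eyx; lia.
Qed.

(** The tubes are [[k + b, k + b + c]] and [[i, i + b]], disjoint because [i < k]. Contracting the
    lower one moves the upper to [[k, k + c]]; contracting the upper one leaves the lower in
    place. *)
Lemma Kcirc_par a b c (i k : 'I_a.+1) : i < k ->
  smcast (Kstar P) (addnAC a b c)
    \c Kcirc P c (inord (k + b) : 'I_(a + b).+1)
    \c (Kcirc P b i \om idm (Kstar P c))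
  = Kcirc P b (inord i : 'I_(a + c).+1) \c (Kcirc P c k \om idm (Kstar P b))
    \c swap23 (Kstar P a) (Kstar P b) (Kstar P c).
Proof.
move=> ik; have ka := ltn_ord k.
have [A [cA [rA [-> inA cAE rAE]]]] :=
  smcast_Kcirc (addnAC a b c) (inord (k + b) : 'I_(a + b).+1).
have [B' [cB' [rB' [-> inB' cBE' rBE']]]] := Kcirc_gcomp b i.
have [B [cB [rB [-> inB cBE rBE]]]] :=
  Kcirc_gcomp b (inord i : 'I_(a + c).+1).
have [A' [cA' [rA' [-> inA' cAE' rAE']]]] := Kcirc_gcomp c k.
have kb : (inord (k + b) : 'I_(a + b).+1) = k + b :> nat.
  by rewrite inordK //; lia.
have ii : (inord i : 'I_(a + c).+1) = i :> nat by rewrite inordK //; lia.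
rewrite kb in inA cAE rAE; rewrite ii in inB cBE rBE.
apply: gcomp_par.
- by apply/pred0P => x; apply/negP; rewrite /= inA inB; lia.
- by move=> x; rewrite inA' cBE inA; do !case: ifP => //=; lia.
- by move=> x; rewrite inB' cAE inB; do !case: ifP => //=; lia.
- move=> x; apply: val_inj; rewrite /= cBE' cAE' cAE cBE.
  by do !case: ifP => //=; lia.
- move=> x y exy; apply: val_inj; rewrite /= rAE' exy cBE rAE.
  by have := valP x; rewrite inA /=; do !case: ifP => //=; lia.
- move=> x y exy; apply: val_inj; rewrite /= rBE' exy cAE rBE.
  by have := valP x; rewrite inB /=; do !case: ifP => //=; lia.
Qed.

(** The block permutation carries the interval at [i] to the one at [s i], inducing [s] on the
    contractions and [t] on the restrictions, so this is naturality of the composition. *)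
Lemma Kcirc_equiv a b (i : 'I_a.+1) (s : 'S_a.+1) (t : 'S_b.+1) :
  Kcirc P b i \c (smact (Kstar P) s \om smact (Kstar P) t)
  = smact (Kstar P) (insert_perm i s t) \c Kcirc P b (s i).
Proof.
have [A [cA [rA [-> inA cAE rAE]]]] := Kcirc_gcomp b i.
have [B [cB [rB [-> inB cBE rBE]]]] := Kcirc_gcomp b (s i).
have [f -> fE] : exists2 f : giso (complete (a + b)) (complete (a + b)),
    smact (Kstar P) (insert_perm i s t) = gmap P f
    & forall x : 'I_(a + b).+1, (f x : 'I_(a + b).+1)
    = (if i <= x <= i + b then s i + t (inord (x - i))
       else let y := s (collapse i x) in if y < s i then y : nat else y + b)
      :> nat.
  exists (complete_perm (insert_perm i s t)) => // x.
  by rewrite ffunE permE insert_funE.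
(* Off the interval the letter differs from [s i], so the test [y < s i] puts its image strictly
   before or strictly after the target interval. *)
have sne (x : 'I_(a + b).+1) :
    ~~ (i <= x <= i + b) -> s (collapse i x) <> s i :> nat.
  move=> xi /val_inj/perm_inj/(congr1 val)/=; rewrite collapseE.
  by case: ifP => ?; [|case: ifP => ?]; lia.
have cAc (x : 'I_(a + b).+1) : cA (proj A x) = collapse i x.
  by apply: val_inj; rewrite /= cAE collapseE.
have [|c [r [eq_cr cE rE]]] :=
  @gmap_gcomp _ P _ _ f A B _ _ cB rB.
  move=> x; rewrite inB inA (fE x); have := sne x.
  have := ltn_ord (t (inord (x - i))).
  by case: ifP => //= ? ?; [lia | move/(_ isT); case: ifP; lia].
rewrite {}eq_cr /gcomp -cmpA -tensmM; congr (_ \c (_ \om _)).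
- apply/esym/gmap_comp_eq => B'; have /existsP[x /eqP<-] := block_surj B'.
  rewrite cE cAc ffunE; apply: val_inj; rewrite /= cBE (fE x).
  have := sne x; have := ltn_ord (t (inord (x - i))).
  have [xi ? _|xi _ /(_ isT)] := boolP (i <= x <= i + b).
    have -> : collapse i x = i.
      by apply: val_inj; rewrite /= collapseE; do !case: ifP => //=; lia.
    by do !case: ifP => //=; lia.
  by move=> /=; do !case: ifP => //=; lia.
- apply/esym/gmap_comp_eq => x; have := valP x; rewrite inA => xi.
  have fxB : f (val x) \in (B : {set complete (a + b)}).
    rewrite inB (fE (val x)) xi; have := ltn_ord (t (inord (val x - i))).
    by rewrite /=; lia.
  rewrite (rE x (exist (fun y => y \in (B : {set complete (a + b)})) _ fxB)) //.
  apply: val_inj; rewrite ffunE /= rBE /= (fE (val x)) xi addKn.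
  congr (nat_of_ord (t _)); apply: val_inj; rewrite /= rAE inordK //.
  by move: xi => /=; lia.
Qed.

End OperadAxioms.

Theorem proposition2p4p1 (C : symMonCat) (P : contractad C) :
  exists O : operad (Kstar P),
    ounit O = cunit P /\
    (forall (a b : nat) (i : 'I_a.+1), ocirc O b i = Kcirc P b i).
Proof.
by exists (Operad (@Kcirc_unitr _ P) (@Kcirc_unitl _ P) (@Kcirc_seq _ P)
                  (@Kcirc_par _ P) (@Kcirc_equiv _ P)).
Qed.
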